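(* Let $v\in\mathrm{Int}(\gamma^a)$ and $F,G\in\mathrm{Mod}(\mathbf{k}_{\mathbb{V}_{\mathfrak{a}}})$. Denote by $d^v_{I_{\mathfrak{a}}}$ (resp. $d^v_{I_\gamma}$) the interleaving distance with respect to $v$ on $\mathrm{Mod}(\mathbf{k}_{\mathbb{V}_{\mathfrak{a}}})$ (resp. $\mathrm{Mod}(\mathbf{k}_{\mathbb{V}_\gamma})$). Then $$d^v_{I_{\mathfrak{a}}}(F,G)=d^v_{I_\gamma}(\beta_*F,\beta_*G).$$
   Context: $\mathbf{k}$ is a field and $\mathbb{V}$ is a finite dimensional real vector space. $\gamma\subset\mathbb{V}$ is a closed convex cone ($\mathbb{R}_{>0}\gamma\subset\gamma$) with non-empty interior, and is proper: $\gamma\cap(-\gamma)=\{0\}$. $\gamma^a=-\gamma$, and $\mathrm{Int}$ denotes the interior for the usual topology. $\mathbb{V}_\gamma$ is $\mathbb{V}$ with the $\gamma$-topology: the open sets are the subsets $U$ which are open for the usual topology and satisfy $U+\gamma=U$. $\mathbb{V}_{\mathfrak{a}}$ is $\mathbb{V}$ with the Alexandrov topology: the open sets are all subsets $U$ with $U+\gamma=U$. $\mathrm{Mod}(\mathbf{k}_{X})$ is the category of sheaves of $\mathbf{k}$-modules on $X$. $\beta\colon\mathbb{V}_{\mathfrak{a}}\to\mathbb{V}_\gamma$ is the identity map, which is continuous, so $(\beta_*F)(U)=F(U)$ for $U$ a $\gamma$-open set. Let $X$ be $\mathbb{V}_{\mathfrak a}$ or $\mathbb{V}_\gamma$. For $v\in\mathbb{V}$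 let $\tau_v\colon x\mapsto x-v$, so that $(\tau_{v*}F)(U)=F(U+v)$. If $v\in\gamma^a$ then $U\subset U+v$ for every open $U$ of $X$, and the restriction maps $F(U+v)\to F(U)$ define a natural morphism $\chi_{v,0}(F)\colon\tau_{v*}F\to F$. $F,G\in\mathrm{Mod}(\mathbf{k}_X)$ are $v$-interleaved ($v\in\gamma^a$) if there are morphisms $f\colon\tau_{v*}F\to G$ and $g\colon\tau_{v*}G\to F$ with $g\circ\tau_{v*}f=\chi_{2v,0}(F)$ and $f\circ\tau_{v*}g=\chi_{2v,0}(G)$. The interleaving distance with respect to $v\in\gamma^a$ is $\inf(\{c\ge 0\mid F\text{ and }G\text{ are }(c\cdot v)\text{-interleaved}\}\cup\{\infty\})$. *)

(* Defs.v *)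
From HB Require Import structures.
From mathcomp Require Import all_boot all_order all_algebra.
From mathcomp Require Import all_classical all_reals.
From mathcomp Require Import convex topology ereal normedtype.
Import Order.TTheory GRing.Theory Num.Theory.
Import VectorInternalTheory.
Import numFieldNormedType.Exports.

Set Implicit Arguments.
Unset Strict Implicit.
Unset Printing Implicit Defensive.

Local Open Scope classical_set_scope.
Local Open Scope ring_scope.

(** * Sheaves of modules on a topological space *)

Record opens (X : topologicalType) := Opens {
  open_carrier :> set X;
  openP : open open_carrier }.

Lemma opens_eq (X : topologicalType) (U W : opens X) :
  (U : set X) = W -> U = W.
Proof.
by case: U W => [U oU] [W oW] /= e; case: _ / e oW => oW;
  rewrite (Prop_irrelevance oU oW).
Qed.

Definition opensI (X : topologicalType) (U W : opens X) : opens X :=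
  @Opens X (U `&` W) (openI (openP U) (openP W)).

Definition opens_preimage (X Y : topologicalType) (f : X -> Y)
    (cf : continuous f) (U : opens Y) : opens X :=
  @Opens X (f @^-1` U) (proj1 (continuousP f) cf U (openP U)).

Record presheaf (k : fieldType) (X : topologicalType) := Presheaf {
  sections :> opens X -> lmodType k;
  res : forall U W : opens X, U `<=` W -> {linear sections W -> sections U};
  res_id : forall (U : opens X) (h : U `<=` U) (s : sections U), res h s = s;
  res_comp : forall (U W Z : opens X) (hUW : U `<=` W) (hWZ : W `<=` Z)
    (hUZ : U `<=` Z) (s : sections Z), res hUW (res hWZ s) = res hUZ s }.

Arguments res {k X} p {U W} h.

Definition is_sheaf (k : fieldType) (X : topologicalType) (F : presheaf k X) :=
  forall (W : opens X) (I : Type) (U : I -> opens X)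
    (sUW : forall i, U i `<=` W),
    W `<=` \bigcup_i U i ->
  forall s : (forall i, F (U i)),
    (forall i j,
      res F (@subIsetl X (U i) (U j) : opensI (U i) (U j) `<=` U i) (s i) =
      res F (@subIsetr X (U i) (U j) : opensI (U i) (U j) `<=` U j) (s j)) ->
  exists! t : F W, forall i, res F (sUW i) t = s i.

Record sheaf (k : fieldType) (X : topologicalType) := Sheaf {
  presheaf_of :> presheaf k X;
  sheafP : is_sheaf presheaf_of }.

Record sheaf_hom (k : fieldType) (X : topologicalType) (F G : sheaf k X) :=
  SheafHom {
  hom_sections :> forall U : opens X, {linear F U -> G U};
  hom_natural : forall (U W : opens X) (h : U `<=` W) (s : F W),
    res G h (hom_sections W s) = hom_sections U (res F h s) }.

Section SheafHom.
Context (k : fieldType) (X : topologicalType).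
Implicit Types F G H : sheaf k X.

Lemma linear_ext (M N : lmodType k) (f g : {linear M -> N}) : f =1 g -> f = g.
Proof.
case: f g => [f [[af] [lf]]] [g [[ag] [lg]]] /= /funext e.
rewrite /= in e; subst g.
by rewrite (Prop_irrelevance af ag) (Prop_irrelevance lf lg).
Qed.

Lemma sheaf_hom_ext F G (f g : sheaf_hom F G) :
  (forall (U : opens X) (s : F U), f U s = g U s) -> f = g.
Proof.
case: f g => [f nf] [g ng] /= e.
have {}e : f = g.
  by apply: functional_extensionality_dep => U; apply/linear_ext/e.
by case: _ / e ng => ng; rewrite (Prop_irrelevance nf ng).
Qed.

Lemma sheaf_hom_comp_natural F G H (g : sheaf_hom G H) (f : sheaf_hom F G)
    (U W : opens X) (h : U `<=` W) (s : F W) :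
  res H h ((g W \o f W) s) = (g U \o f U) (res F h s).
Proof. by rewrite /= !hom_natural. Qed.

Definition sheaf_hom_comp F G H (g : sheaf_hom G H) (f : sheaf_hom F G) :
    sheaf_hom F H :=
  @SheafHom k X F H (fun U => g U \o f U : {linear F U -> H U})
    (@sheaf_hom_comp_natural F G H g f).

End SheafHom.

Section DirectImage.
Context (k : fieldType) (X Y : topologicalType) (f : X -> Y).
Context (cf : continuous f).
Local Notation pre := (opens_preimage cf).

Section Presheaf.
Context (F : presheaf k X).

Definition direct_image_res (U W : opens Y) (h : U `<=` W) :
    {linear F (pre W) -> F (pre U)} :=
  res F (@preimage_subset X Y f U W h : pre U `<=` pre W).

Lemma direct_image_res_id (U : opens Y) (h : U `<=` U) (s : F (pre U)) :
  direct_image_res h s = s.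
Proof. exact: res_id. Qed.

Lemma direct_image_res_comp (U W Z : opens Y) (hUW : U `<=` W)
    (hWZ : W `<=` Z) (hUZ : U `<=` Z) (s : F (pre Z)) :
  direct_image_res hUW (direct_image_res hWZ s) = direct_image_res hUZ s.
Proof. exact: res_comp. Qed.

Definition direct_image_presheaf : presheaf k Y :=
  @Presheaf k Y (fun U => F (pre U)) direct_image_res
    direct_image_res_id direct_image_res_comp.

End Presheaf.

Lemma direct_image_is_sheaf (F : sheaf k X) :
  is_sheaf (direct_image_presheaf F).
Proof.
move=> W I U sUW cov s comp.
have [|i j|t [Ht Hu]] := @sheafP k X F (pre W) I (fun i => pre (U i))
  (fun i => @preimage_subset X Y f _ _ (sUW i)) _ s.
- by move=> x /cov[i _ Uix]; exists i.
- have sE : opensI (pre (U i)) (pre (U j)) `<=` pre (opensI (U i) (U j)).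
    by [].
  have := congr1 (res F sE) (comp i j).
  by rewrite /= /direct_image_res (res_comp sE _ (@subIsetl _ _ _))
    (res_comp sE _ (@subIsetr _ _ _)).
- by exists t; split.
Qed.

Definition direct_image (F : sheaf k X) : sheaf k Y :=
  Sheaf (@direct_image_is_sheaf F).

Definition direct_image_hom (F G : sheaf k X) (u : sheaf_hom F G) :
    sheaf_hom (direct_image F) (direct_image G) :=
  @SheafHom k Y (direct_image F) (direct_image G) (fun U => u (pre U))
    (fun U W h => hom_natural u (preimage_subset h : pre U `<=` pre W)).

End DirectImage.

Lemma subr_cst_continuous (R : numFieldType) (W : normedModType R) (w : W) :
  continuous (fun y : W => y - w).
Proof. by move=> y; apply: cvgB; [exact: cvg_id|exact: cvg_cst]. Qed.

(** * Cones and the topologies they define *)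

(* [v2r] identifies [V] with R^(dim V); since all linear bijections of R^n are
   homeomorphisms, the initial topology is the usual topology of [V]. *)
Definition usual (R : realType) (V : vectType R) : Type :=
  initial_topology (v2r : V -> 'rV[R]_(dim V)).

HB.instance Definition _ (R : realType) (V : vectType R) :=
  Topological.copy (usual V) (initial_topology (v2r : V -> 'rV[R]_(dim V))).

Definition antipode (V : zmodType) (A : set V) : set V := [set - x | x in A].

Record proper_cone (R : realType) (V : vectType R) := ProperCone {
  cone_carrier :> set V;
  cone_closed : closed (cone_carrier : set (usual V));
  cone_convex : convex_set (cone_carrier : set (convex_lmodType V));
  cone_scale : forall (a : R) (x : V),
    0 < a -> cone_carrier x -> cone_carrier (a *: x);
  cone_interior : (cone_carrier : set (usual V))° !=set0;
  cone_proper : cone_carrier `&` antipode cone_carrier = [set 0] }.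

Definition minkowski_sum (V : zmodType) (A B : set V) : set V :=
  [set x + y | x in A & y in B].

Variant cone_topology := Alexandrov | Gamma.

Section ConeSpace.
Context (R : realType) (V : vectType R).
Implicit Types (t : cone_topology) (c : proper_cone V).

Lemma antipodeE (A : set V) v : antipode A v = A (- v).
Proof.
apply/propext; split=> [[x Ax <-]|Av]; first by rewrite opprK.
by exists (- v) => //; rewrite opprK.
Qed.

Lemma cone0 c : cone_carrier c 0.
Proof. by have [] : ((c : set V) `&` antipode c) 0 by rewrite cone_proper. Qed.

Definition cone_open t c (U : set V) : Prop :=
  match t with
  | Alexandrov => minkowski_sum U c = U
  | Gamma => open (U : set (usual V)) /\ minkowski_sum U c = U
  end.

Lemma minkowski_coneP c (U : set V) :
  minkowski_sum U c = U <-> (forall x y, U x -> cone_carrier c y -> U (x + y)).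
Proof.
split=> [e x y Ux cy|h]; first by rewrite -e; exists x => //; exists y.
apply/seteqP; split=> [_ [x Ux [y cy <-]]|x Ux]; first exact: h.
by exists x => //; exists 0; [exact: cone0|rewrite addr0].
Qed.

Lemma cone_open_stable t c (U : set V) :
  cone_open t c U -> forall x y, U x -> cone_carrier c y -> U (x + y).
Proof. by case: t => [|[_]] /minkowski_coneP. Qed.

Lemma cone_openT t c : cone_open t c setT.
Proof. by case: t; [|split; first exact: openT]; exact/minkowski_coneP. Qed.

Lemma cone_openI t c : setI_closed (cone_open t c).
Proof.
move=> A B oA oB.
have AB : minkowski_sum (A `&` B) c = A `&` B.
  apply/minkowski_coneP => x y [Ax Bx] cy.
  by split; [exact: cone_open_stable oA _ _ _ _|
             exact: cone_open_stable oB _ _ _ _].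
by case: t oA oB => //= [[oA _]] [oB _]; split=> //; exact: openI.
Qed.

Lemma cone_open_bigU t c (I : Type) (f : I -> set V) :
  (forall i, cone_open t c (f i)) -> cone_open t c (\bigcup_i f i).
Proof.
move=> hf.
have AB : minkowski_sum (\bigcup_i f i) c = \bigcup_i f i.
  apply/minkowski_coneP => x y [i _ fx] cy.
  by exists i => //; exact: cone_open_stable (hf i) _ _ _ _.
by case: t hf => //= hf; split=> //; apply: bigcup_open => i _; case: (hf i).
Qed.

Definition cone_space t c : Type := V.

HB.instance Definition _ t c := Choice.copy (cone_space t c) V.
HB.instance Definition _ t c := isOpenTopological.Build (cone_space t c)
  (cone_openT t c) (@cone_openI t c) (@cone_open_bigU t c).

Lemma cone_spaceE t c (U : set (cone_space t c)) : open U = cone_open t c U.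
Proof. by []. Qed.

Lemma coneZ c (a : R) v : 0 <= a -> cone_carrier c v -> cone_carrier c (a *: v).
Proof.
rewrite le_eqVlt => /predU1P[<- _|a0 cv]; last exact: cone_scale.
by rewrite scale0r; exact: cone0.
Qed.

Definition translation t c (v : V) (x : cone_space t c) : cone_space t c :=
  (x : V) - v.

Lemma usual_open_translation (v : V) (U : set V) :
  open (U : set (usual V)) -> open ([set x | U (x - v)] : set (usual V)).
Proof.
case=> A oA <-.
have cf : continuous (fun y : 'rV[R]_(dim V) => y - v2r v).
  exact: (@subr_cst_continuous R _ (v2r v)).
exists ((fun y => y - v2r v) @^-1` A); first exact: (proj1 (continuousP _) cf).
by apply/seteqP; split=> x /=; rewrite linearB.
Qed.

Lemma cone_open_translation t c v (U : set V) :
  cone_open t c U -> cone_open t c [set x | U (x - v)].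
Proof.
move=> oU.
have stable : minkowski_sum [set x | U (x - v)] c = [set x | U (x - v)].
  apply/minkowski_coneP => x y Ux cy; rewrite /= addrAC.
  exact: cone_open_stable oU _ _ Ux cy.
by case: t oU => //= -[oU _]; split=> //; exact: usual_open_translation.
Qed.

Lemma translation_continuous t c v : continuous (@translation t c v).
Proof. by apply/continuousP => U; exact: cone_open_translation. Qed.

Definition tau_preimage t c v : opens (cone_space t c) -> opens (cone_space t c) :=
  opens_preimage (@translation_continuous t c v).

Lemma tau_subset t c (v : V) (U : opens (cone_space t c)) :
  antipode c v -> U `<=` tau_preimage v U.
Proof.
rewrite antipodeE => cv x Ux.
exact: (@cone_open_stable t c U (openP U) x (- v) Ux cv).
Qed.

Definition beta c (x : cone_space Alexandrov c) : cone_space Gamma c := x.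

Lemma beta_continuous c : continuous (@beta c).
Proof. by apply/continuousP => U [_ sU]. Qed.

End ConeSpace.

Arguments tau_subset {R V t c v} U _.

(** * Interleavings *)

Section Interleaving.
Context (k : fieldType) (R : realType) (V : vectType R).
Context (t : cone_topology) (c : proper_cone V).
Local Notation X := (cone_space t c).
Implicit Types (v : V) (F G : sheaf k X).

(* The preimage of [U] under [x |-> x - v] is [U + v]. *)
Definition tau v F : sheaf k X :=
  direct_image (@translation_continuous R V t c v) F.

Definition tau_hom v F G (f : sheaf_hom F G) : sheaf_hom (tau v F) (tau v G) :=
  direct_image_hom (@translation_continuous R V t c v) f.

Lemma chi_natural v F (hv : antipode c v) (U W : opens X) (h : U `<=` W)
    (s : tau v F W) :
  res F h (res F (tau_subset W hv) s) =
  res F (tau_subset U hv) (res (tau v F) h s).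
Proof.
have hU : U `<=` tau_preimage v W := subset_trans h (tau_subset W hv).
by rewrite (res_comp _ _ hU) [RHS](res_comp _ _ hU).
Qed.

Definition chi v F (hv : antipode c v) : sheaf_hom (tau v F) F :=
  @SheafHom k X (tau v F) F (fun U => res F (tau_subset U hv))
    (@chi_natural v F hv).

Lemma tau_double_subset v (U : opens X) :
  tau_preimage v (tau_preimage v U) `<=` tau_preimage (v *+ 2) U.
Proof. by move=> x /=; rewrite /translation mulr2n opprD addrA. Qed.

Arguments tau_double_subset : clear implicits.

Lemma tau_double_natural v F (U W : opens X) (h : U `<=` W)
    (s : tau (v *+ 2) F W) :
  res (tau v (tau v F)) h (res F (tau_double_subset v W) s) =
  res F (tau_double_subset v U) (res (tau (v *+ 2) F) h s).
Proof.
have hU : tau_preimage v (tau_preimage v U) `<=` tau_preimage (v *+ 2) W.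
  by apply: subset_trans (tau_double_subset v W); do 2!apply: preimage_subset.
by rewrite [LHS](res_comp _ _ hU) [RHS](res_comp _ _ hU).
Qed.

(* The two sides are equal only up to the propositional equality
   [(x - v) - v = x - 2v]: this is the canonical identification, given by
   restriction along an equality of open sets. *)
Definition tau_double v F : sheaf_hom (tau (v *+ 2) F) (tau v (tau v F)) :=
  @SheafHom k X (tau (v *+ 2) F) (tau v (tau v F))
    (fun U => res F (tau_double_subset v U)) (@tau_double_natural v F).

Lemma antipode_double v : antipode c v -> antipode c (v *+ 2).
Proof.
rewrite !antipodeE -mulNrn -scaler_nat => cv.
by apply: coneZ cv; rewrite ler0n.
Qed.

Definition interleaved v F G : Prop :=
  exists hv : antipode c v,
  exists (f : sheaf_hom (tau v F) G) (g : sheaf_hom (tau v G) F),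
    sheaf_hom_comp (sheaf_hom_comp g (tau_hom v f)) (tau_double v F)
      = chi F (antipode_double hv) /\
    sheaf_hom_comp (sheaf_hom_comp f (tau_hom v g)) (tau_double v G)
      = chi G (antipode_double hv).

Definition interleaving_distance v F G : \bar R :=
  ereal_inf ([set a%:E | a in [set a : R | 0 <= a /\ interleaved (a *: v) F G]]
             `|` [set +oo%E]).

End Interleaving.

Definition beta_direct_image (k : fieldType) (R : realType) (V : vectType R)
    (c : proper_cone V) (F : sheaf k (cone_space Alexandrov c)) :
    sheaf k (cone_space Gamma c) :=
  direct_image (@beta_continuous R V c) F.

(* Main.v *)
Require Import Defs.
From mathcomp Require Import all_boot all_order all_algebra.
From mathcomp Require Import all_classical all_reals.
From mathcomp Require Import topology ereal normedtype.
Import Order.TTheory GRing.Theory Num.Theory.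
Import VectorInternalTheory.
Import numFieldNormedType.Exports.

Set Implicit Arguments.
Unset Strict Implicit.
Unset Printing Implicit Defensive.

Local Open Scope classical_set_scope.

(** The distance for the gamma-topology is at most the one for the Alexandrov
    topology because beta_* commutes with translations: an interleaving of [F]
    and [G] restricts to the gamma-open sets ([beta_interleaved]).

    The converse inequality is obtained at the cost of an arbitrarily small
    [e > 0].  Write [U + w] for the translate of an Alexandrov open set [U].
    Since [- v] is interior to the cone, the usual interior [(U + e v)°] is a
    gamma-open set squeezed between [U] and [U + e v].  A morphism [f] from
    tau_(a v)* beta_* F to beta_* G therefore yields, for every [U], the map

      F (U + (a + e) v) -> F ((U + e v)° + a v) -> G ((U + e v)°) -> G (U)

    whose middle arrow is [f] and whose other arrows are restrictions
    ([thicken_hom]).  In the composite of two such maps, naturality moves the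
    restrictions between the two given morphisms to one end; what is left is
    the composite of [f] and [g] on a gamma-open set, which is a restriction
    ([thicken_retraction]).  So an [a v]-interleaving of the direct images gives
    an [(a + e) v]-interleaving of [F] and [G], and the infima agree. *)

Local Open Scope ring_scope.

Lemma res_irrelevance (k : fieldType) (X : topologicalType) (F : presheaf k X)
    (U W : opens X) (h h' : U `<=` W) (s : F W) : res F h s = res F h' s.
Proof. by rewrite (Prop_irrelevance h h'). Qed.

Lemma res_square (k : fieldType) (X : topologicalType) (F : presheaf k X)
    (U W W' Z : opens X) (hU : U `<=` W) (hZ : W `<=` Z) (hU' : U `<=` W')
    (hZ' : W' `<=` Z) (s : F Z) :
  res F hU (res F hZ s) = res F hU' (res F hZ' s).
Proof. by rewrite !(res_comp _ _ (subset_trans hU hZ)). Qed.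

(** * Interleavings on sections *)

Section Retraction.
Context (k : fieldType) (R : realType) (V : vectType R).
Context (t : cone_topology) (c : proper_cone V).
Local Notation X := (cone_space t c).
Implicit Types (v : V) (F G : sheaf k X).

(** One half of an interleaving, with both translations by [v] performed
    successively: this avoids the identification of the translate by [2 v] with
    the iterated translate by [v]. *)
Definition shift_retraction v F G (f : sheaf_hom (tau v F) G)
    (g : sheaf_hom (tau v G) F) : Prop :=
  forall (U : opens X) (h : U `<=` tau_preimage v (tau_preimage v U))
    (s : F (tau_preimage v (tau_preimage v U))),
  g U (f (tau_preimage v U) s) = res F h s.

Lemma shift_retractionP v F G (hv : antipode c v) (f : sheaf_hom (tau v F) G)
    (g : sheaf_hom (tau v G) F) :
  sheaf_hom_comp (sheaf_hom_comp g (tau_hom v f)) (tau_double v F)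
    = chi F (antipode_double hv) <-> shift_retraction f g.
Proof.
split=> [e U h s|fg].
  have h2 : tau_preimage (v *+ 2) U `<=` tau_preimage v (tau_preimage v U).
    by move=> x /=; rewrite /translation mulr2n opprD addrA.
  have := congr1 (fun u : sheaf_hom (tau (v *+ 2) F) F => u U (res F h2 s)) e.
  rewrite /= (res_comp _ _ (@subset_refl _ _)) res_id => ->.
  exact: res_comp.
apply: sheaf_hom_ext => U s /=.
have h := subset_trans (tau_subset U hv) (tau_subset (tau_preimage v U) hv).
by rewrite (fg _ h); exact: res_comp.
Qed.

Lemma interleavedP v F G :
  interleaved v F G <->
  antipode c v /\
  exists (f : sheaf_hom (tau v F) G) (g : sheaf_hom (tau v G) F),
    shift_retraction f g /\ shift_retraction g f.
Proof.
split=> [[hv [f [g [/shift_retractionP fg /shift_retractionP gf]]]]|].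
  by split=> //; exists f, g.
by move=> [hv [f [g [fg gf]]]]; exists hv, f, g; split; apply/shift_retractionP.
Qed.

End Retraction.

(** * Restricting an interleaving to the gamma-open sets *)

Section Beta.
Context (k : fieldType) (R : realType) (V : vectType R) (c : proper_cone V).
Implicit Types (v : V) (F G : sheaf k (cone_space Alexandrov c)).
Local Notation beta_pre := (opens_preimage (@beta_continuous R V c)).

Section Hom.
Context (v : V) (F G : sheaf k (cone_space Alexandrov c)).
Context (f : sheaf_hom (tau v F) G).

Lemma tau_beta_subset (U : opens (cone_space Gamma c)) :
  tau_preimage v (beta_pre U) `<=` beta_pre (tau_preimage v U).
Proof. by []. Qed.

Definition beta_hom_sections (U : opens (cone_space Gamma c)) :
    {linear tau v (beta_direct_image F) U -> beta_direct_image G U} :=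
  f (beta_pre U) \o res F (@tau_beta_subset U).

Lemma beta_hom_natural (U W : opens (cone_space Gamma c)) (h : U `<=` W)
    (s : tau v (beta_direct_image F) W) :
  res (beta_direct_image G) h (beta_hom_sections W s) =
  beta_hom_sections U (res (tau v (beta_direct_image F)) h s).
Proof.
have h' : beta_pre U `<=` beta_pre W by [].
rewrite /= /direct_image_res.
rewrite (res_irrelevance _ h') (hom_natural f h') /= /direct_image_res.
by congr (f _ _); exact: (@res_square _ _ F (tau_preimage v (beta_pre U))).
Qed.

(** The restriction in [beta_hom_sections] is along an equality of sets: it
    implements the isomorphism between tau_v* beta_* F and beta_* tau_v* F. *)
Definition beta_hom :
    sheaf_hom (tau v (beta_direct_image F)) (beta_direct_image G) :=
  @SheafHom k _ (tau v (beta_direct_image F)) (beta_direct_image G)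
    beta_hom_sections beta_hom_natural.

End Hom.

Lemma beta_retraction v F G (f : sheaf_hom (tau v F) G)
    (g : sheaf_hom (tau v G) F) :
  shift_retraction f g -> shift_retraction (beta_hom f) (beta_hom g).
Proof.
move=> fg U h s /=.
have h1 : tau_preimage v (beta_pre U) `<=` beta_pre (tau_preimage v U) by [].
rewrite (res_irrelevance _ h1) (hom_natural f h1) /= /direct_image_res.
rewrite fg.
have h2 : tau_preimage v (tau_preimage v (beta_pre U)) `<=`
  beta_pre (tau_preimage v (tau_preimage v U)) by [].
by rewrite (res_comp _ _ h2); exact: res_comp.
Qed.

Lemma beta_interleaved v F G :
  interleaved v F G ->
  interleaved v (beta_direct_image F) (beta_direct_image G).
Proof.
move=> /interleavedP[hv [f [g [fg gf]]]]; apply/interleavedP; split=> //.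
by exists (beta_hom f), (beta_hom g); split; exact: beta_retraction.
Qed.

End Beta.

(** * Gamma-open thickenings *)

Lemma affine_continuous (R : numFieldType) (W : normedModType R)
    (a : R) (w : W) :
  continuous (fun x : W => w + a *: x).
Proof. by move=> x; apply: cvgD; [exact: cvg_cst|exact: scaler_continuous]. Qed.

Section UsualTopology.
Context (R : realType) (V : vectType R).

Lemma usual_open_affine (a : R) (w : V) (U : set V) :
  open (U : set (usual V)) -> open ([set x | U (w + a *: x)] : set (usual V)).
Proof.
case=> A oA <-.
have cf := @affine_continuous R 'rV[R]_(dim V) a (v2r w).
exists ((fun y => v2r w + a *: y) @^-1` A).
  exact: (proj1 (continuousP _) cf).
by apply/seteqP; split=> x /=; rewrite linearD linearZ.
Qed.

Lemma usual_interior_affine (a : R) (w x : V) (A : set V) :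
  (A : set (usual V))° (w + a *: x) ->
  ([set z | A (w + a *: z)] : set (usual V))° x.
Proof.
move=> Ax.
pose B : set (usual V) := [set z | (A : set (usual V))° (w + a *: z)].
have oB : open B by apply: usual_open_affine; exact: open_interior.
have : B `<=` [set z | A (w + a *: z)] by move=> z; exact: interior_subset.
by rewrite (open_subsetE _ oB); exact.
Qed.

End UsualTopology.

Section Thicken.
Context (R : realType) (V : vectType R) (c : proper_cone V) (v : V).
Context (hv : (antipode c : set (usual V))° v).
Local Notation beta_pre := (opens_preimage (@beta_continuous R V c)).
Implicit Types U W : opens (cone_space Alexandrov c).

(** The interior stays stable under adding [y] in the cone because translation
    by [y] is a homeomorphism mapping the given set into itself. *)
Lemma thicken_open (e : R) U :
  open ((tau_preimage (e *: v) U : set (usual V))° : set (cone_space Gamma c)).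
Proof.
rewrite cone_spaceE; split; first exact: open_interior.
apply/minkowski_coneP => x y Ux cy.
have : ([set z | (tau_preimage (e *: v) U : set V) (- y + 1 *: z)]
  : set (usual V))° (x + y).
  by apply: usual_interior_affine; rewrite scale1r addrC addrK.
apply: interiorS => z /=; rewrite scale1r => Uz.
rewrite -[z](addrNK y) (addrC z).
exact: (@cone_open_stable _ _ Alexandrov c _ (openP (tau_preimage (e *: v) U))).
Qed.

Definition thicken (e : R) U : opens (cone_space Gamma c) :=
  Opens (thicken_open e U).

Lemma thicken_subset (e : R) U :
  beta_pre (thicken e U) `<=` tau_preimage (e *: v) U.
Proof. by move=> x; exact: interior_subset. Qed.

Lemma thickenS (e : R) U W : U `<=` W -> thicken e U `<=` thicken e W.
Proof. by move=> h; apply: (@interiorS (usual V)) => x; exact: h. Qed.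

(** The point [z] lies in [x + e v + c] as soon as [v + (x - z) / e] lies in
    [- c]; this is an open condition on [z], and at [z = x] it says that [v] is
    interior to [- c]. *)
Lemma subset_thicken (e : R) U : 0 < e -> U `<=` beta_pre (thicken e U).
Proof.
move=> e0 x Ux.
have : ([set z | antipode c ((v + e^-1 *: x) + (- e^-1) *: z)]
  : set (usual V))° x.
  by apply: usual_interior_affine; rewrite scaleNr addrK.
apply: interiorS => z; rewrite /= antipodeE /translation => cz.
have -> : (z : V) - e *: v = x + e *: - (v + e^-1 *: x + - e^-1 *: z).
  rewrite scalerN !scalerDr !scalerA mulrN divff ?gt_eqF// scaleN1r scale1r.
  rewrite !opprD opprK [- (e *: v) - x]addrC !addrA subrr add0r.
  by rewrite addrC.
apply: (@cone_open_stable _ _ Alexandrov c _ (openP U)) => //.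
exact: cone_scale.
Qed.

Lemma tau_thicken_subset (a e : R) U :
  beta_pre (tau_preimage (a *: v) (thicken e U)) `<=`
  tau_preimage ((a + e) *: v) U.
Proof.
move=> x /thicken_subset /=.
by rewrite /translation scalerDl opprD addrA.
Qed.

(** Both sides are gamma-open: the Alexandrov open set [U + (a + e) v] fits
    between them. *)
Lemma tau_thickenS (a e : R) U : 0 < e ->
  tau_preimage (a *: v) (thicken e U) `<=`
  thicken e (tau_preimage ((a + e) *: v) U).
Proof.
move=> e0.
exact: subset_trans (@tau_thicken_subset a e U) (subset_thicken e0).
Qed.

(** * Extending an interleaving from the gamma-open sets *)

Section Hom.
Context (k : fieldType) (F G : sheaf k (cone_space Alexandrov c)).
Context (a e : R) (e0 : 0 < e).
Context (f : sheaf_hom (tau (a *: v) (beta_direct_image F))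
  (beta_direct_image G)).

Definition thicken_hom_sections U : {linear tau ((a + e) *: v) F U -> G U} :=
  res G (subset_thicken e0) \o
    (f (thicken e U) \o res F (@tau_thicken_subset a e U)).

Lemma thicken_hom_natural U W (h : U `<=` W) (s : tau ((a + e) *: v) F W) :
  res G h (thicken_hom_sections W s) =
  thicken_hom_sections U (res (tau ((a + e) *: v) F) h s).
Proof.
have /(congr1 (res G (subset_thicken e0))) fnat := hom_natural f
  (thickenS (e := e) h) (res F (@tau_thicken_subset a e W) s).
transitivity (res G (subset_thicken e0)
    (res (beta_direct_image G) (thickenS (e := e) h)
      (f (thicken e W) (res F (@tau_thicken_subset a e W) s)))).
  exact: (@res_square _ _ G).
rewrite fnat /=; congr (res G _ (f _ _)); exact: (@res_square _ _ F).
Qed.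

Definition thicken_hom : sheaf_hom (tau ((a + e) *: v) F) G :=
  @SheafHom k _ (tau ((a + e) *: v) F) G
    thicken_hom_sections thicken_hom_natural.

End Hom.

(** The two restrictions on [G] compose to one between the gamma-open sets
    [(U + e v)° + a v] and [(U + (a + e) v + e v)°], so naturality of [f] applies
    to it although [U] itself need not be gamma-open. *)
Lemma thicken_retraction (k : fieldType)
    (F G : sheaf k (cone_space Alexandrov c)) (a e : R) (e0 : 0 < e)
    (cav : antipode c (a *: v))
    (f : sheaf_hom (tau (a *: v) (beta_direct_image F)) (beta_direct_image G))
    (g : sheaf_hom (tau (a *: v) (beta_direct_image G)) (beta_direct_image F)) :
  shift_retraction f g ->
  shift_retraction (thicken_hom e0 f) (thicken_hom e0 g).
Proof.
move=> fg U h s; pose W := tau_preimage ((a + e) *: v) U.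
have hG : tau_preimage (a *: v) (thicken e U) `<=` thicken e W.
  exact: tau_thickenS.
rewrite /= (res_comp _ _
  (preimage_subset hG : beta_pre _ `<=` beta_pre (thicken e W))).
have := hom_natural f hG (res F (@tau_thicken_subset a e W) s).
move=> /(congr1 (g (thicken e U))) fnat.
have hF := subset_trans (tau_subset (thicken e U) cav)
  (tau_subset (tau_preimage (a *: v) (thicken e U)) cav).
rewrite (fg _ hF) in fnat.
etransitivity; first exact: (congr1 (res F (subset_thicken e0)) fnat).
have h1 : beta_pre (thicken e U) `<=`
    beta_pre (tau_preimage (a *: v) (thicken e W)).
  by move=> x /hF; exact: hG.
have h2 := subset_trans h1 (@tau_thicken_subset a e W).
by rewrite /= /direct_image_res (res_comp _ _ h1) (res_comp _ _ h2) res_comp.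
Qed.

Lemma thicken_interleaved (k : fieldType)
    (F G : sheaf k (cone_space Alexandrov c)) (a e : R) : 0 <= a -> 0 < e ->
  interleaved (a *: v) (beta_direct_image F) (beta_direct_image G) ->
  interleaved ((a + e) *: v) F G.
Proof.
move=> a0 e0 /interleavedP[cav [f [g [fg gf]]]]; apply/interleavedP; split.
  have : antipode c v by exact: interior_subset hv.
  rewrite !antipodeE -scalerN; apply: coneZ.
  by rewrite addr_ge0// ltW.
exists (thicken_hom e0 f), (thicken_hom e0 g).
by split; exact: thicken_retraction.
Qed.

End Thicken.

(** * Comparison of the distances *)

Theorem corollary4p26 (k : fieldType) (R : realType) (V : vectType R)
    (c : proper_cone V) (v : V)
    (hv : (antipode c : set (usual V))° v)
    (F G : sheaf k (cone_space Alexandrov c)) :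
  interleaving_distance v F G =
  interleaving_distance v (beta_direct_image F) (beta_direct_image G).
Proof.
apply/eqP; rewrite eq_le; apply/andP; split; last first.
  apply: le_ereal_inf_tmp => _ [[a [a0 /beta_interleaved FG]] <-|->].
    by apply: ereal_inf_lbound; left; exists a.
  exact: leey.
apply: le_ereal_inf_tmp => _ [[a [a0 FG]] <-|->]; last exact: leey.
apply/lee_addgt0Pr => e e0.
apply: ereal_inf_lbound; left; exists (a + e) => //; split.
  by rewrite addr_ge0// ltW.
exact: thicken_interleaved.
Qed.
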